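(* Let $\ell\ge r\ge2$ and let $\mathcal{H}$ be a $\mathcal{K}_{\ell+1}^r$-free $r$-graph. Then \[ \left(\frac{|\mathcal{H}|}{\binom{\ell}{r}}\right)^{1/r}\le\left(\frac{|\partial\mathcal{H}|}{\binom{\ell}{r-1}}\right)^{1/(r-1)}. \]
   Context: An $r$-graph $\mathcal{H}$ is a finite vertex set $V(\mathcal{H})$ together with a set of $r$-element subsets (edges). The shadow is $\partial\mathcal{H}=\{A\in\binom{V(\mathcal{H})}{r-1}: A\subset B\text{ for some }B\in\mathcal{H}\}$. $\mathcal{K}_{\ell+1}^r$ is the collection of all $r$-graphs $F$ with at most $\binom{\ell+1}{2}$ edges such that for some $(\ell+1)$-set $S$ every pair $\{u,v\}\subset S$ is contained in some edge of $F$; $\mathcal{H}$ is $\mathcal{K}_{\ell+1}^r$-free if it contains no member of $\mathcal{K}_{\ell+1}^r$ as a (not necessarily induced) subgraph. *)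

(* Defs.v *)
From mathcomp Require Import all_boot.

Set Implicit Arguments.
Unset Strict Implicit.
Unset Printing Implicit Defensive.

(* A hypergraph on the vertex set V is identified with its set of edges. *)
Definition is_rgraph (r : nat) (V : finType) (H : {set {set V}}) : Prop :=
  forall e : {set V}, e \in H -> #|e| = r.

Definition shadow (r : nat) (V : finType) (H : {set {set V}}) : {set {set V}} :=
  [set A : {set V} | (#|A| == r.-1) && [exists B in H, A \subset B]].

(* [in_Kfam r k F] says that F belongs to the family usually written K_k^r:
   F is an r-graph with at most 'C(k, 2) edges that covers all pairs of
   distinct vertices of some k-element set S. *)
Definition in_Kfam (r k : nat) (W : finType) (F : {set {set W}}) : Prop :=
  [/\ is_rgraph r F,
      #|F| <= 'C(k, 2)
    & exists2 S : {set W}, #|S| = k &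
        forall u v : W, u \in S -> v \in S -> u != v ->
          exists2 e : {set W}, e \in F & [set u; v] \subset e].

(* H contains a copy of F as a (not necessarily induced) subgraph. *)
Definition contains_copy (V W : finType) (H : {set {set V}})
    (F : {set {set W}}) : Prop :=
  exists2 f : W -> V, injective f &
    forall e : {set W}, e \in F -> f @: e \in H.

Definition Kfam_free (r k : nat) (V : finType) (H : {set {set V}}) : Prop :=
  forall (W : finType) (F : {set {set W}}), in_Kfam r k F -> ~ contains_copy H F.

(* Main.v *)
Require Import Defs.
From mathcomp Require Import classical_sets topology normedtype derive realfun.
From mathcomp Require Import function_spaces.
From mathcomp Require Import all_boot all_order all_algebra.
From mathcomp Require Import lra ring.
From mathcomp Require Import reals exp.

(* For vertex weights [x >= 0] let [W(x)] and [S(x)] be the total weights of the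
   edges of [H] and of its shadow, an edge weighing the product of its vertex
   weights. If no edge contains both [u] and [v], then [W] and [S] are affine in
   [(x_u, x_v)], so all the mass of [u] and [v] can be moved onto one of them
   without increasing [S] or decreasing [W]. Starting from [x = 1] this ends with
   a support whose pairs are all covered, hence of at most [l] vertices.

   It remains to show, for an [r]-graph on at most [l] vertices, that
   [S = C(l, r - 1) y^(r - 1)] implies [W <= C(l, r) y^r]. If this fails at [x0],
   maximise [W - C(l, r) y^r] over [0 <= x <= x0], where [y] is now the function
   of [x] defined by [S]. At the maximum decreasing [x_v] does not help, so
   [h_v >= (l - r + 1) / (r - 1) y s_v] for the partial derivatives [h_v], [s_v]
   of [W], [S]; these are the same weights for the link of [v], and induction on
   [r] gives [s_v >= C(l - 1, r - 2) y^(r - 2)] when [s_v > 0]. Summing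
   [x_v s_v] yields [sum x_v <= l y] over such [v], and the weighted local LYM
   inequality [l r W <= (l - r + 1) S (sum x_v)] concludes. *)

Set Implicit Arguments.
Unset Strict Implicit.
Unset Printing Implicit Defensive.

Import Order.TTheory GRing.Theory Num.Theory.
Local Open Scope ring_scope.

(** * Links, shadows and how they interact *)

Definition link (V : finType) (v : V) (H : {set {set V}}) : {set {set V}} :=
  [set A : {set V} | (v \notin A) && (v |: A \in H)].

Definition weight (R : realType) (V : finType) (x : V -> R)
    (H : {set {set V}}) : R :=
  \sum_(A in H) \prod_(i in A) x i.

Definition update (R : realType) (V : finType) (x : V -> R) (v : V) (a : R) :
    V -> R :=
  fun i => if i == v then a else x i.

Section Hypergraphs.
Variable V : finType.
Implicit Types (H : {set {set V}}) (A B : {set V}) (v w : V).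

Lemma link_rgraph r H v : is_rgraph r.+1 H -> is_rgraph r (link v H).
Proof.
move=> Hr A; rewrite inE => /andP[vA /Hr]; rewrite cardsU1 vA add1n.
by case.
Qed.

Lemma shadow_rgraph r H : is_rgraph r (shadow r.+1 H).
Proof. by move=> A; rewrite inE => /andP[/eqP]. Qed.

Lemma link_shadow r H v A : is_rgraph r.+1 H -> A \in link v H -> A \in shadow r.+1 H.
Proof.
move=> Hr Al; rewrite inE (link_rgraph Hr Al) eqxx /=.
apply/existsP; exists (v |: A); rewrite subsetUr andbT.
by move: Al; rewrite inE => /andP[].
Qed.

(** This makes the derivative [s_v] of the shadow weight itself a shadow weight, that of the link of
    [v], so that induction on the uniformity applies to it. *)
Lemma shadow_link r H v : link v (shadow r.+2 H) = shadow r.+1 (link v H).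
Proof.
apply/setP => A; rewrite !inE /=.
apply/idP/idP.
  case/and3P=> vA; rewrite cardsU1 vA add1n eqSS => -> /existsP[B /andP[BH sB]].
  have vB : v \in B by apply: (subsetP sB); rewrite setU11.
  apply/existsP; exists (B :\ v); rewrite !inE eqxx /= setD1K // BH /=.
  by rewrite subsetD1 vA andbT (subset_trans _ sB) // subsetUr.
case/andP=> cA /existsP[B /andP[]]; rewrite inE => /andP[vB BH sAB].
have vA : v \notin A by apply: contra vB; exact: (subsetP sAB).
rewrite vA cardsU1 vA add1n eqSS cA /=; apply/existsP; exists (v |: B).
by rewrite BH setUS.
Qed.

Lemma cover_link H v : cover (link v H) \subset cover H :\ v.
Proof.
apply/bigcupsP => A; rewrite inE => /andP[vA AH]; rewrite subsetD1 vA andbT.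
by apply: subset_trans (bigcup_sup _ AH); rewrite subsetUr.
Qed.

Lemma big_link (T : Type) (idx : T) (op : Monoid.com_law idx) H v (F : {set V} -> T) :
  \big[op/idx]_(A in link v H) F A = \big[op/idx]_(B in H | v \in B) F (B :\ v).
Proof.
rewrite (reindex_onto (fun B => B :\ v) (fun A => v |: A)) /=; last first.
  by move=> A; rewrite inE => /andP[vA _]; rewrite setU1K.
apply: eq_bigl => B; rewrite !inE eqxx /=.
have [vB|vB] := boolP (v \in B); first by rewrite setD1K // eqxx.
rewrite andbF; apply/andP => -[_ /eqP E]; case/negP: vB.
by rewrite -E setU11.
Qed.

End Hypergraphs.

(** * Weights as polynomials, and the weighted local LYM inequality *)

Section Weights.
Variables (R : realType) (V : finType).
Implicit Types (H : {set {set V}}) (A B : {set V}) (v w : V) (x : V -> R).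

Lemma prod_ge0 x A : (forall i, 0 <= x i) -> 0 <= \prod_(i in A) x i.
Proof. by move=> x0; apply: prodr_ge0. Qed.

Lemma weight_ge0 x H : (forall i, 0 <= x i) -> 0 <= weight x H.
Proof. by move=> x0; apply: sumr_ge0 => A _; exact: prod_ge0. Qed.

Lemma weight_sub x H H' :
  (forall i, 0 <= x i) -> H \subset H' -> weight x H <= weight x H'.
Proof.
move=> x0 sH; rewrite /weight [leRHS](big_setID H) /= (setIidPr sH) lerDl.
by apply: sumr_ge0 => A _; exact: prod_ge0.
Qed.

Lemma eq_weight x x' H :
  (forall i, i \in cover H -> x i = x' i) -> weight x H = weight x' H.
Proof.
move=> E; apply: eq_bigr => A AH; apply: eq_bigr => i iA; apply: E.
by apply/bigcupP; exists A.
Qed.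

Lemma weight_link x H v :
  x v * weight x (link v H) = \sum_(B in H | v \in B) \prod_(i in B) x i.
Proof.
rewrite /weight big_link mulr_sumr; apply: eq_bigr => B /andP[_ vB].
by rewrite [RHS](big_setD1 v).
Qed.

Lemma weight_split x H v :
  weight x H = x v * weight x (link v H) + weight x [set B in H | v \notin B].
Proof.
rewrite weight_link {1}/weight (bigID (fun B => v \in B)) /=; congr (_ + _).
by apply: eq_bigl => B; rewrite inE.
Qed.

(** Each edge product is affine in [x v], so the change is exact, with the link weight as partial
    derivative. *)
Lemma weight_update x H v a :
  weight (update x v a) H = weight x H + (a - x v) * weight x (link v H).
Proof.
rewrite (weight_split (update x v a) H v) (weight_split x H v) {1}/update eqxx.
rewrite (@eq_weight (update x v a) x (link v H)); last first.
  move=> i /(subsetP (cover_link _ _)); rewrite !inE /update.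
  by case/andP => /negbTE->.
rewrite (@eq_weight (update x v a) x [set B in H | v \notin B]); first by ring.
move=> i /bigcupP[B]; rewrite inE => /andP[_ vB] iB; rewrite /update.
by case: eqP => // E; rewrite -E iB in vB.
Qed.

(** Euler's identity for a homogeneous polynomial of degree [r]: each edge is counted once for each
    of its vertices. *)
Lemma sum_weight_link r x H : is_rgraph r H ->
  \sum_v x v * weight x (link v H) = r%:R * weight x H.
Proof.
move=> Hr; under eq_bigr do rewrite weight_link.
rewrite (exchange_big_dep (mem H)) /=; last by move=> v B _ /andP[].
rewrite mulr_sumr; apply: eq_bigr => B BH.
under eq_bigl do rewrite BH.
by rewrite sumr_const (Hr _ BH) mulr_natl.
Qed.

(* Both sides sum over the flags [A] in [B = A + w] with [B] in [H]. *)
Lemma sum_flags r H (F : {set V} -> V -> R) : is_rgraph r.+1 H ->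
  \sum_(B in H) \sum_(w in B) F (B :\ w) w
  = \sum_(A in shadow r.+1 H) \sum_(w | A \in link w H) F A w.
Proof.
move=> Hr; rewrite (exchange_big_dep predT) //= [RHS](exchange_big_dep predT) //=.
apply: eq_bigr => w _; rewrite -(@big_link _ _ _ _ _ w (fun A => F A w)).
by apply: eq_bigl => A; apply/idP/andP => [Al|[]//]; split=> //; exact: link_shadow Al.
Qed.

(* AM-GM on each pair [u, w] in [B]:
   [2 x_B <= x_(B - w) x_u + x_(B - u) x_w]. *)
Lemma sum_flags_ge r x B : (forall i, 0 <= x i) -> #|B| = r.+1 ->
  (r.+1 * r)%:R * \prod_(i in B) x i
  <= \sum_(w in B) (\prod_(i in B :\ w) x i) * \sum_(u in B :\ w) x u.
Proof.
move=> x0 cB; set P := fun w => \prod_(i in B :\ w) x i.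
have PE w : w \in B -> \prod_(i in B) x i = x w * P w.
  by move=> wB; rewrite (big_setD1 w).
set S := leRHS.
have SE : S = \sum_(w in B) \sum_(u in B | u != w) P w * x u.
  apply: eq_bigr => w wB; rewrite mulr_sumr; apply: eq_bigl => u.
  by rewrite !inE andbC.
have SE' : S = \sum_(w in B) \sum_(u in B | u != w) P u * x w.
  rewrite SE (exchange_big_dep (mem B)) /=; last by move=> i j _ /andP[].
  apply: eq_bigr => w wB; apply: eq_bigl => u.
  by rewrite wB eq_sym.
have cE : (r.+1 * r)%:R * \prod_(i in B) x i
    = \sum_(w in B) \sum_(u in B | u != w) \prod_(i in B) x i.
  rewrite [RHS](eq_bigr (fun=> (\prod_(i in B) x i) *+ r)).
    by rewrite sumr_const cB -mulrnA mulr_natl mulnC.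
  move=> w wB; rewrite sumr_const; congr (_ *+ _).
  rewrite (@eq_card _ _ (mem (B :\ w))); last by move=> u; rewrite !inE andbC.
  by move: (cardsD1 w B); rewrite wB cB add1n => -[].
suff : 2 * ((r.+1 * r)%:R * \prod_(i in B) x i) <= S + S by lra.
rewrite {1}SE SE' -big_split cE mulr_sumr; apply: ler_sum => w wB.
rewrite -big_split mulr_sumr /=; apply: ler_sum => u /andP[uB uw].
have wBu : w \in B :\ u by rewrite !inE eq_sym uw.
have uBw : u \in B :\ w by rewrite !inE uw.
rewrite (PE _ wB) /P (big_setD1 u uBw) (big_setD1 w wBu) /=.
have -> : B :\ w :\ u = B :\ u :\ w by apply/setP => i; rewrite !inE andbCA.
set Q := \prod_(i in _) x i.
have Q0 : 0 <= Q by exact: prod_ge0.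
have : 0 <= Q * (x u - x w) ^+ 2 by rewrite mulr_ge0 // sqr_ge0.
by rewrite sqrrB !expr2; nra.
Qed.

(** The inner sum over [w] counts each edge [r.+1] times. For the sum over [v], AM-GM on flags
    applies: a shadow set [A] lies in at most [l - r] flags, since the vertices completing it lie in
    [cover H :\: A]. Writing [l = (l - r) + r] adds the two contributions. *)
Lemma weighted_LYM l r x H :
  (forall i, 0 <= x i) -> is_rgraph r.+1 H -> (#|cover H| <= l)%N -> (r <= l)%N ->
  (l * r.+1)%:R * weight x H
  <= (l - r)%:R * \sum_(A in shadow r.+1 H) (\prod_(i in A) x i)
       * (\sum_(v in A) x v + \sum_(w | A \in link w H) x w).
Proof.
move=> x0 Hr cH rl.
set T := \sum_(A in shadow r.+1 H) (\prod_(i in A) x i) * \sum_(v in A) x v.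
have N : \sum_(A in shadow r.+1 H) (\prod_(i in A) x i)
    * (\sum_(w | A \in link w H) x w) = r.+1%:R * weight x H.
  under eq_bigr do rewrite mulr_sumr.
  rewrite -(@sum_flags _ _ (fun A w => \prod_(i in A) x i * x w)) //.
  rewrite mulr_sumr; apply: eq_bigr => B BH; rewrite -(Hr _ BH).
  rewrite [LHS](eq_bigr (fun=> \prod_(i in B) x i)).
    by rewrite sumr_const mulr_natl.
  by move=> w wB; rewrite [RHS](big_setD1 w) //= mulrC.
have T_ge : (r.+1 * r)%:R * weight x H <= (l - r)%:R * T.
  apply: (@le_trans _ _ (\sum_(B in H) \sum_(w in B)
      (\prod_(i in B :\ w) x i) * \sum_(u in B :\ w) x u)).
    rewrite mulr_sumr; apply: ler_sum => B BH.
    exact: sum_flags_ge (Hr _ BH).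
  rewrite (@sum_flags r H (fun A _ => (\prod_(i in A) x i) * \sum_(u in A) x u)) //.
  rewrite mulr_sumr; apply: ler_sum => A As; rewrite sumr_const -[leLHS]mulr_natl.
  apply: ler_wpM2r; first by rewrite mulr_ge0 ?prod_ge0 ?sumr_ge0.
  rewrite ler_nat; apply: (@leq_trans #|cover H :\: A|).
    apply/subset_leq_card/subsetP => w wl.
    have: A \in link w H by exact: wl.
    rewrite inE => /andP[wA AH].
    rewrite inE wA /=; apply/bigcupP; exists (w |: A); rewrite ?setU11 //.
  have sA : A \subset cover H.
    move: As; rewrite inE => /andP[_ /existsP[B /andP[BH sB]]].
    by apply: subset_trans sB _; exact: bigcup_sup BH.
  rewrite cardsD (setIidPr sA) (shadow_rgraph As).
  exact: leq_sub2r.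
rewrite (eq_bigr _ (fun A _ => mulrDr _ _ _)) big_split /= -/T N.
have lE : l%:R = (l - r)%:R + r%:R :> R by rewrite -natrD subnK.
by move: T_ge; rewrite !natrM lE => T_ge; nra.
Qed.

(** Induction: the next case is [b] times the previous one plus
    [n.+1 * a ^ n * (a - b) ^ 2 >= 0]. *)
Lemma big_AMGM (a b : R) n : 0 <= a -> 0 <= b ->
  n.+1%:R * a ^+ n * b <= n%:R * a ^+ n.+1 + b ^+ n.+1.
Proof.
move=> a0 b0; elim: n => [|n IH]; first by rewrite expr0 !expr1; lra.
have an : 0 <= n.+1%:R * (a ^+ n * (a - b) ^+ 2).
  apply: mulr_ge0; first exact: ler0n.
  by apply: mulr_ge0; [exact: exprn_ge0|exact: sqr_ge0].
move: (ler_wpM2l b0 IH) an; rewrite !exprS expr0 -[n.+2%:R]natr1 -[n.+1%:R]natr1.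
move: (a ^+ n) (b ^+ n) (n%:R : R) => p q m IH' an.
by lra.
Qed.

End Weights.

(** * From link bounds to the weight bound, and symmetrisation *)

Section Concentration.
Variables (R : realType) (V : finType).
Implicit Types (H : {set {set V}}) (A B : {set V}) (v w : V) (x : V -> R).

Lemma natr_bin_succ (l k : nat) :
  k.+1%:R * 'C(l, k.+1)%:R = (l - k)%:R * 'C(l, k)%:R :> R.
Proof. by rewrite -!natrM mul_bin_left. Qed.

Lemma natr_bin_diag (l k : nat) :
  l.+1%:R * 'C(l, k)%:R = k.+1%:R * 'C(l.+1, k.+1)%:R :> R.
Proof. by rewrite -!natrM mul_bin_diag. Qed.

Lemma weight_gt0 x H A : (forall i, 0 <= x i) -> A \in H ->
  \prod_(i in A) x i != 0 -> 0 < weight x H.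
Proof.
move=> x0 AH xA; rewrite /weight (bigD1 A) //= ltr_wpDr //.
  by apply: sumr_ge0 => B _; exact: prod_ge0.
by rewrite lt_def xA prod_ge0.
Qed.

(** Euler's identity for the shadow turns the lower bounds on link weights into an upper bound on
    the mass [e1], which the LYM inequality turns into a bound on [weight x H]. *)
Lemma weight_le_of_links l k x (y : R) H :
  (forall i, 0 <= x i) -> 0 <= y -> is_rgraph k.+2 H ->
  (#|cover H| <= l.+1)%N -> (k < l)%N ->
  weight x (shadow k.+2 H) <= 'C(l.+1, k.+1)%:R * y ^+ k.+1 ->
  (forall v, 0 < x v -> 0 < weight x (link v (shadow k.+2 H)) ->
     'C(l, k)%:R * y ^+ k <= weight x (link v (shadow k.+2 H))) ->
  weight x H <= 'C(l.+1, k.+2)%:R * y ^+ k.+2.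
Proof.
move=> x0 y0 Hr cH kl S_le links.
set S := weight x (shadow _ H) in S_le.
set e1 := \sum_(v | 0 < weight x (link v (shadow k.+2 H))) x v.
have S0 : 0 <= S by exact: weight_ge0.
have e0 : 0 <= e1 by apply: sumr_ge0.
(* If [A] has nonzero weight, its vertices and the vertices completing it to an edge all count in
   [e1]: removing one vertex of [A] gives a set of nonzero weight in the relevant link. The two
   kinds of vertices are disjoint, so the LYM bracket is at most [e1]. *)
have W_le : (l.+1 * k.+2)%:R * weight x H <= (l.+1 - k.+1)%:R * (S * e1).
  apply: le_trans (weighted_LYM x0 Hr cH _) _; first by rewrite ltnW.
  apply: ler_wpM2l; first exact: ler0n.
  rewrite /S /weight mulr_suml; apply: ler_sum => A As.
  have [xA0|xA] := eqVneq (\prod_(i in A) x i) 0; first by rewrite xA0 !mul0r.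
  apply: ler_wpM2l; first exact: prod_ge0.
  have sD u : u \in A -> A :\ u \in shadow k.+1 [set A] /\ \prod_(i in A :\ u) x i != 0.
    move=> uA; split.
      rewrite inE; apply/andP; split.
        by move: (cardsD1 u A); rewrite uA (shadow_rgraph As) add1n => -[<-].
      by apply/existsP; exists A; rewrite inE eqxx subsetDl.
    by apply: contraNneq xA => E; rewrite (big_setD1 u) //= E mulr0.
  rewrite /e1 [X in X + _]big_mkcond [X in _ + X]big_mkcond [leRHS]big_mkcond.
  rewrite -big_split /=; apply: ler_sum => v _.
  have [vA|vA] := boolP (v \in A).
    rewrite [_ \in link v H]inE vA addr0 (_ : 0 < _) //.
    apply: (@weight_gt0 _ _ (A :\ v)) => //; last by case: (sD v vA).
    by rewrite inE setD1K // As !inE eqxx.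
  have [Al|] := boolP (A \in link v H); last first.
    by move=> _; rewrite addr0; case: ifP.
  rewrite add0r (_ : 0 < _) // shadow_link.
  have [u uA] : exists u, u \in A.
    by apply/set0Pn; rewrite -card_gt0 (shadow_rgraph As).
  have [D1 D2] := sD u uA; apply: (@weight_gt0 _ _ (A :\ u)) => //.
  move: D1; rewrite !inE => /andP[-> /existsP[B /andP[/set1P-> sB]]].
  by apply/existsP; exists A; rewrite Al.
have ke1 : 'C(l, k)%:R * y ^+ k * e1 <= k.+1%:R * S.
  rewrite /S -(sum_weight_link x (@shadow_rgraph _ k.+1 H)) mulr_sumr.
  rewrite [leRHS](bigID (fun v => 0 < weight x (link v (shadow k.+2 H)))) /=.
  rewrite -[leLHS]addr0; apply: lerD; last first.
    by apply: sumr_ge0 => v _; apply: mulr_ge0 => //; exact: weight_ge0.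
  apply: ler_sum => v sv; rewrite mulrC.
  have := x0 v; rewrite le_eqVlt => /orP[/eqP<-|xv]; first by rewrite !mul0r.
  by rewrite ler_pM2l // links.
have l0 : 0 < (l.+1 * k.+2)%:R :> R by rewrite ltr0n.
rewrite -(ler_pM2l l0); apply: le_trans W_le _.
(* The bound on [e1] needs division by [y ^+ k]; for [y = 0] the shadow weight [S] vanishes
   instead. *)
have [yE|yn] := eqVneq y 0.
  move: S_le; rewrite yE !expr0n /= !mulr0.
  move=> S_le; have -> : S = 0 by apply/le_anti/andP.
  by rewrite mul0r mulr0.
have yp : 0 < y by rewrite lt_def yn.
have e1_le : e1 <= l.+1%:R * y.
  have c0 : 0 < 'C(l, k)%:R * y ^+ k by rewrite mulr_gt0 ?exprn_gt0 // ltr0n bin_gt0 ltnW.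
  rewrite -(ler_pM2l c0); apply: le_trans ke1 _.
  apply: (@le_trans _ _ (k.+1%:R * ('C(l.+1, k.+1)%:R * y ^+ k.+1))).
    by rewrite ler_wpM2l.
  by rewrite mulrA -natr_bin_diag exprS le_eqVlt; apply/orP; left; apply/eqP; ring.
apply: (@le_trans _ _ ((l.+1 - k.+1)%:R
    * (('C(l.+1, k.+1)%:R * y ^+ k.+1) * (l.+1%:R * y)))).
  apply: ler_wpM2l; first exact: ler0n.
  exact: ler_pM.
rewrite natrM [leRHS](_ : _ = l.+1%:R * (k.+2%:R * 'C(l.+1, k.+2)%:R) * y ^+ k.+2).
  rewrite natr_bin_succ le_eqVlt; apply/orP; left; apply/eqP.
  by rewrite [y ^+ k.+2]exprSr; ring.
by ring.
Qed.

(** No monomial contains both variables, so changing [x u] leaves the link weight of [v] unchanged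
    and no cross term arises. *)
Lemma weight_update2 H x u v a b : u != v ->
  (forall A, A \in H -> ~~ ([set u; v] \subset A)) ->
  weight (update (update x u a) v b) H
  = weight x H + (a - x u) * weight x (link u H) + (b - x v) * weight x (link v H).
Proof.
move=> uv unc; rewrite weight_update [weight (update x u a) H]weight_update.
rewrite (@eq_weight _ _ (update x u a) x (link v H)).
  by rewrite {1}/update eq_sym (negbTE uv).
move=> i il; rewrite /update; case: eqP => // iu; move: il.
case/bigcupP => A; rewrite inE iu => /andP[_ AH] uA.
by case/negP: (unc _ AH); rewrite subUset !sub1set !inE uA eqxx orbT.
Qed.

Lemma shadow_uncovered r H (C : {set V}) :
  (forall A, A \in H -> ~~ (C \subset A)) ->
  forall A, A \in shadow r H -> ~~ (C \subset A).
Proof.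
move=> unc A; rewrite inE => /andP[_ /existsP[B /andP[BH sB]]].
by apply: contra (unc B BH) => sC; exact: subset_trans sC sB.
Qed.

Lemma link_weight_eq0 k H x u : (forall i, 0 <= x i) -> is_rgraph k.+2 H ->
  weight x (link u (shadow k.+2 H)) = 0 -> weight x (link u H) = 0.
Proof.
rewrite shadow_link => x0 Hr s0; apply: big1 => A Al.
have cA := link_rgraph Hr Al.
have [w wA] : exists w, w \in A by apply/set0Pn; rewrite -card_gt0 cA.
rewrite (big_setD1 w) //= [X in _ * X](_ : _ = 0) ?mulr0 //.
have Ds : A :\ w \in shadow k.+1 (link u H).
  rewrite inE; apply/andP; split.
    by move: (cardsD1 w A); rewrite wA cA add1n => -[<-].
  by apply/existsP; exists A; rewrite Al subsetDl.
apply/eqP; rewrite -[_ == _]andTb.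
move/eqP: s0; rewrite /weight psumr_eq0; last by move=> B _; exact: prod_ge0.
by move/allP/(_ (A :\ w) (mem_index_enum _)); rewrite Ds.
Qed.

(** Mass goes to the vertex with the larger ratio of link weight in [H] to link weight in the
    shadow; the [wlog] compares these ratios cross-multiplied, since a denominator may vanish. *)
Lemma shift_mass k H x u v : (forall i, 0 <= x i) -> is_rgraph k.+2 H -> u != v ->
  0 < x u -> 0 < x v ->
  (forall A, A \in H -> ~~ ([set u; v] \subset A)) ->
  exists x', [/\ forall i, 0 <= x' i,
    (#|[set i | (0 < x' i)%R]| < #|[set i | (0 < x i)%R]|)%N,
    weight x' (shadow k.+2 H) <= weight x (shadow k.+2 H)
    & weight x H <= weight x' H].
Proof.
move=> x0 Hr uv xu xv unc.
wlog le_uv : u v uv xu xv unc / weight x (link v H) * weight x (link u (shadow k.+2 H))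
    <= weight x (link u H) * weight x (link v (shadow k.+2 H)).
  move=> th; case: (leP (weight x (link v H) * weight x (link u (shadow k.+2 H)))
    (weight x (link u H) * weight x (link v (shadow k.+2 H)))); first exact: th.
  move=> /ltW; apply: th => //; first by rewrite eq_sym.
  by move=> A; rewrite setUC; exact: unc.
have unc' := @shadow_uncovered k.+2 _ _ unc.
have su0 : 0 <= weight x (link u (shadow k.+2 H)) by exact: weight_ge0.
have sv0 : 0 <= weight x (link v (shadow k.+2 H)) by exact: weight_ge0.
have hu0 : 0 <= weight x (link u H) by exact: weight_ge0.
have hv0 : 0 <= weight x (link v H) by exact: weight_ge0.
have supp a b : (0 < a -> 0 < b -> False) ->
  (#|[set i | (0 < update (update x u a) v b i)%R]| < #|[set i | (0 < x i)%R]|)%N.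
  move=> ab; apply: proper_card; apply/properP; split.
    apply/subsetP => i; rewrite !inE /update.
    by case: eqP => [->//|_]; case: eqP => [->|].
  have [a0|a0] := ltP 0 a; [exists v|exists u]; rewrite !inE ?xu ?xv // /update.
    by rewrite eqxx; apply/negP/ab.
  by rewrite eqxx (negbTE uv) -leNgt.
(* With [s_u = 0] also [h_u = 0], so [u] can be emptied without changing either weight. *)
have [su|su] := eqVneq (weight x (link u (shadow k.+2 H))) 0.
  exists (update (update x u 0) v (x v)); split.
  - by move=> i; rewrite /update; case: eqP => // _; case: eqP.
  - by apply: supp; rewrite ltxx.
  - by rewrite weight_update2 // su subrr mul0r mulr0 !addr0.
  - by rewrite weight_update2 // (link_weight_eq0 x0 Hr su) subrr mul0r mulr0 !addr0.
have sup : 0 < weight x (link u (shadow k.+2 H)) by rewrite lt_def su.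
(* The exchange rate at which emptying [v] and adding [d] to [u] leaves the shadow weight
   unchanged. *)
set d := x v * weight x (link v (shadow k.+2 H)) / weight x (link u (shadow k.+2 H)).
have d0 : 0 <= d by rewrite divr_ge0 // mulr_ge0.
exists (update (update x u (x u + d)) v 0); split.
- move=> i; rewrite /update; case: eqP => // _; case: eqP => // _.
  by rewrite addr_ge0.
- by apply: supp; rewrite ltxx.
- rewrite weight_update2 // [x u + d - x u]addrC addKr /d divfK //.
  by rewrite sub0r mulNr addrK.
- rewrite weight_update2 // [x u + d - x u]addrC addKr sub0r mulNr -addrA lerDl.
  rewrite subr_ge0 -(ler_pM2r sup) [leRHS]mulrAC /d divfK //.
  by rewrite -!mulrA ler_pM2l // [leRHS]mulrC.
Qed.

(* The symmetrisation of Motzkin and Straus. *)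
Lemma concentrate_on_covered k H x : (forall i, 0 <= x i) -> is_rgraph k.+2 H ->
  exists x', [/\ forall i, 0 <= x' i,
    forall u v, 0 < x' u -> 0 < x' v -> u != v ->
      exists2 e, e \in H & [set u; v] \subset e,
    weight x' (shadow k.+2 H) <= weight x (shadow k.+2 H)
    & weight x H <= weight x' H].
Proof.
move=> + Hr; have [n] := ubnP #|[set i | 0 < x i]|.
elim: n x => // n IH x; rewrite ltnS => cx x0.
have [/existsP[u /existsP[v /and4P[xu xv uv /forallP unc]]]|cov] :=
  boolP [exists u, exists v, [&& 0 < x u, 0 < x v, u != v &
    [forall A, (A \in H) ==> ~~ ([set u; v] \subset A)]]].
  have [|x1 [x10 cx1 S1 W1]] := shift_mass x0 Hr uv xu xv.
    by move=> A AH; have := unc A; rewrite AH.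
  have [x2 [x20 cov S2 W2]] := IH x1 (leq_trans cx1 cx) x10.
  by exists x2; split=> //; [exact: le_trans S2 S1|exact: le_trans W1 W2].
exists x; split=> // u v xu xv uv.
move: cov; rewrite negb_exists => /forallP/(_ u).
rewrite negb_exists => /forallP/(_ v); rewrite xu xv uv /= negb_forall.
by case/existsP => e; rewrite negb_imply negbK => /andP[eH se]; exists e.
Qed.

End Concentration.

(** * Existence of a constrained maximum *)

Section Maximum.
Import numFieldNormedType.Exports.
Variables (R : realType) (V : finType).
Implicit Types (G H : {set {set V}}) (x : V -> R).

Lemma weight_continuous (T : topologicalType) (f : T -> V -> R) H :
  (forall v, continuous (fun p => f p v)) ->
  continuous (fun p => weight (f p) H).
Proof.
move=> cf; refine (@continuous_big R _ +%R 0 (mem H) (@add_continuous R) T _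
  (fun A p => \prod_(i in A) f p i) _) => A _.
exact: (@continuous_big R _ *%R 1 (mem A) (@mul_continuous R) T _ (fun i p => f p i)).
Qed.

(** The box is compact by Tychonoff's theorem, the constraint cuts out a closed subset, and the
    objective is a polynomial, hence continuous. *)
Lemma constrained_max G H (a c : R) (m n : nat) x0 (y0 : R) :
  let D (p : (V -> R) * R) := [/\ forall v, 0 <= p.1 v <= x0 v, 0 <= p.2 <= y0
    & weight p.1 G <= a * p.2 ^+ m] in
  D (x0, y0) ->
  exists2 p, D p & forall q, D q ->
    weight q.1 H - c * q.2 ^+ n <= weight p.1 H - c * p.2 ^+ n.
Proof.
move=> D D0.
pose T := ((prod_topology (fun _ : V => R)) * R)%type.
pose K : classical_sets.set T :=
  [set p | (forall v, `[0, x0 v]%classic (p.1 v)) /\ `[0, y0]%classic p.2]%classic.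
have cK : compact K.
  apply: (@compact_setX (prod_topology (fun _ : V => R)) R
     [set f | forall v, `[0, x0 v]%classic (f v)]%classic).
    exact: (@tychonoff V (fun _ => R) (fun v => `[0, x0 v]%classic)
      (fun v => @segment_compact R 0 (x0 v))).
  exact: segment_compact.
have cw H' : continuous (fun p : T => weight p.1 H').
  apply: weight_continuous => v p.
  apply: (@continuous_comp _ _ _ (fun p : T => p.1) (fun f => f v)).
    exact: cvg_fst.
  exact: (@proj_continuous V (fun _ => R) v).
have cy n' b : continuous (fun p : T => b * p.2 ^+ n').
  move=> p; apply: (@cvgM R T (nbhs p) _ (fun=> b) (fun p => p.2 ^+ n')).
    exact: cvg_cst.
  apply: (@continuous_comp T R R (fun p : T => p.2) (fun z => z ^+ n')).
    exact: cvg_snd.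
  exact: exprn_continuous.
have cF H' b n' : continuous (fun p : T => weight p.1 H' - b * p.2 ^+ n').
  move=> p; apply: (@cvgB R R T (nbhs p) _ (fun p => weight p.1 H')
    (fun p => b * p.2 ^+ n')); [exact: cw|exact: cy].
pose L : classical_sets.set T := [set p | weight p.1 G <= a * p.2 ^+ m]%classic.
have clL : topology_structure.closed L.
  rewrite (_ : L = (fun p : T => weight p.1 G - a * p.2 ^+ m)
      @^-1` [set z | z <= 0])%classic.
    apply: preimage_closed => [p _|]; last exact: closed_le.
    exact: cF.
  by apply/seteqP; split=> p /=; rewrite subr_le0.
have cKL : compact (K `&` L)%classic by exact: compact_closedI.
have DE p : D p <-> (K `&` L)%classic p.
  have KE : K p <-> (forall v, 0 <= p.1 v <= x0 v) /\ 0 <= p.2 <= y0.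
    rewrite /K /= in_itv; split=> -[h1 ?]; (split; last by []) => v.
      by have := h1 v; rewrite in_itv.
    by rewrite in_itv; exact: h1.
  split=> [[h1 h2 h3]|[/KE[h1 h2] h3]]; last by split.
  by split; first by apply/KE.
have [||c0 c0D c0M] := @compact_EVT_max T R
    (fun p => weight p.1 H - c * p.2 ^+ n) (K `&` L)%classic _ cKL.
- by exists (x0, y0); apply/DE.
- by apply: continuous_subspaceT => p; exact: cF.
exists c0; first by apply/DE/set_mem.
by move=> q /DE qD; apply: c0M; apply/mem_set.
Qed.

End Maximum.

(** * The weighted inequality on few vertices *)

Section WeightedShadow.
Variables (R : realType) (V : finType).
Implicit Types (G H : {set {set V}}) (x : V -> R).

Lemma root_exists (s : R) n : 0 <= s -> exists2 z : R, 0 <= z & z ^+ n.+1 = s.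
Proof.
move=> s0; exists (s `^ n.+1%:R^-1); first exact: powR_ge0.
by rewrite -powR_mulrn ?powR_ge0 // -powRrM mulVf ?pnatr_eq0 // powRr1.
Qed.

(* At a maximum of [weight H - c * y ^+ k.+2] no vertex weight can usefully be
   decreased, which bounds every vertex derivative of [weight H] from below by
   the corresponding derivative of the shadow weight. *)
Lemma link_ge_at_max l k H x (y : R) v :
  let S x := weight x (shadow k.+2 H) in
  (forall i, 0 <= x i) -> 0 <= y -> (k < l)%N ->
  S x = 'C(l, k.+1)%:R * y ^+ k.+1 ->
  0 < x v -> 0 < weight x (link v (shadow k.+2 H)) ->
  (forall t z, 0 <= t <= x v -> 0 <= z <= y ->
     S (update x v (x v - t)) = 'C(l, k.+1)%:R * z ^+ k.+1 ->
     weight (update x v (x v - t)) H - 'C(l, k.+2)%:R * z ^+ k.+2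
     <= weight x H - 'C(l, k.+2)%:R * y ^+ k.+2) ->
  (l - k.+1)%:R * y * weight x (link v (shadow k.+2 H))
  <= k.+1%:R * weight x (link v H).
Proof.
move=> S x0 y0 kl SE xv s_gt0 max.
set s := weight x (link v (shadow _ _)) in s_gt0 *; set h := weight x (link v H).
have h0 : 0 <= h by exact: weight_ge0.
set a : R := 'C(l, k.+1)%:R in SE max *; set c : R := 'C(l, k.+2)%:R in max.
have a0 : 0 < a by rewrite ltr0n bin_gt0.
have ac : k.+2%:R * c = (l - k.+1)%:R * a by exact: natr_bin_succ.
rewrite leNgt; apply/negP => hlt.
have lk : 0 < (l - k.+1)%:R :> R.
  rewrite lt_def ler0n andbT; apply/eqP => E; move: hlt.
  by rewrite E !mul0r ltNge mulr_ge0.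
(* The value of [y] at which the claimed inequality would be an equality; its negation says
   [z0 < y]. *)
set z0 := k.+1%:R * h / ((l - k.+1)%:R * s).
have d0 : 0 < (l - k.+1)%:R * s by exact: mulr_gt0.
have z00 : 0 <= z0 by apply: divr_ge0; [exact: mulr_ge0|exact: ltW].
have z0y : z0 < y by rewrite /z0 ltr_pdivrMr // mulrA [y * _]mulrC.
have e0 : 0 < y ^+ k.+1 - z0 ^+ k.+1 by rewrite subr_gt0 ltrXn2r.
(* So small a decrease of [x v] that the new value [z], given by
   [z ^+ k.+1 = y ^+ k.+1 - t * s / a], stays above [z0]; maximality will force [z <= z0]. *)
set t := Num.min (x v) (a * (y ^+ k.+1 - z0 ^+ k.+1) / s / 2).
have q0 : 0 < a * (y ^+ k.+1 - z0 ^+ k.+1) / s / 2.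
  by rewrite divr_gt0 // divr_gt0 // mulr_gt0.
have t0 : 0 < t by rewrite lt_min xv.
have tx : t <= x v by rewrite ge_min lexx.
have tq : t * s / a <= (y ^+ k.+1 - z0 ^+ k.+1) / 2.
  rewrite ler_pdivrMr // -ler_pdivlMr //.
  apply: (@le_trans _ _ (a * (y ^+ k.+1 - z0 ^+ k.+1) / s / 2)).
    by rewrite ge_min lexx orbT.
  by rewrite le_eqVlt; apply/orP; left; apply/eqP; ring.
have p0 : 0 <= z0 ^+ k.+1 by rewrite exprn_ge0.
have [z z_ge0 zE] : exists2 z : R, 0 <= z & z ^+ k.+1 = y ^+ k.+1 - t * s / a.
  by apply: root_exists; move: tq e0 p0; move: (t * s / a) => *; lra.
have tsa : 0 < t * s / a by rewrite divr_gt0 // mulr_gt0.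
have zy : z <= y.
  by rewrite -(@ler_pXn2r _ k.+1) ?nnegrE // zE; lra.
have z0z : z0 < z.
  by rewrite -(@ltr_pXn2r _ k.+1) ?nnegrE // zE; lra.
have := max t z; rewrite (ltW t0) tx z_ge0 zy => /(_ isT isT).
have xt : x v - t - x v = - t by ring.
rewrite /S !weight_update xt -/s -/h -[weight x (shadow _ H)]/(S x) SE.
have -> : a * y ^+ k.+1 + - t * s = a * z ^+ k.+1.
  by rewrite zE mulrBr mulrCA divff ?gt_eqF // mulr1 mulNr.
move=> /(_ erefl) Hmax.
have := @big_AMGM R y z k.+1 y0 z_ge0.
have ytz : y ^+ k.+1 = z ^+ k.+1 + t * s / a by rewrite zE subrK.
move=> am.
(* Together: [k.+2 c z (y^k.+1 - z^k.+1) <= k.+1 c (y^k.+2 - z^k.+2) <= k.+1 t h]. *)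
have cn : 0 <= c by exact: ler0n.
have h1 : k.+1%:R * (c * (y ^+ k.+2 - z ^+ k.+2)) <= k.+1%:R * (t * h).
  by apply: ler_wpM2l => //; move: Hmax; lra.
have h2 : k.+2%:R * c * z * (t * s / a) <= k.+1%:R * (c * (y ^+ k.+2 - z ^+ k.+2)).
  have -> : t * s / a = y ^+ k.+1 - z ^+ k.+1 by rewrite ytz addrAC subrr add0r.
  have := ler_wpM2l cn am; rewrite [z ^+ k.+2]exprSr -[k.+2%:R]natr1.
  by move: (z ^+ k.+1) (y ^+ k.+1) (y ^+ k.+2) (k.+1%:R : R) => *; lra.
have : (l - k.+1)%:R * z * s * t <= k.+1%:R * h * t.
  apply: (@le_trans _ _ (k.+2%:R * c * z * (t * s / a))).
    rewrite ac le_eqVlt; apply/orP; left; apply/eqP.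
    by field; rewrite gt_eqF.
  by apply: le_trans h2 _; apply: le_trans h1 _; rewrite -mulrA [h * t]mulrC.
rewrite ler_pM2r // => hz.
have : z <= z0 by rewrite /z0 ler_pdivlMr // mulrA [z * _]mulrC.
by rewrite leNgt z0z.
Qed.

(** Induction on [k]. A counterexample [(x0, y0)] makes the objective positive, hence also its
    maximum over the box, while the link bounds at the maximum make it nonpositive. *)
Lemma weighted_shadow k l H x (y : R) :
  (forall i, 0 <= x i) -> 0 <= y -> is_rgraph k.+2 H ->
  (#|cover H| <= l.+1)%N -> (k < l)%N ->
  weight x (shadow k.+2 H) <= 'C(l.+1, k.+1)%:R * y ^+ k.+1 ->
  weight x H <= 'C(l.+1, k.+2)%:R * y ^+ k.+2.
Proof.
elim: k l H x y => [|k IH] l H x0 y0 x00 y00 Hr cH kl S0.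
  (* For graphs, the shadow of a nonempty link is [[set set0]], of weight 1. *)
  apply: weight_le_of_links S0 _ => // v _; rewrite bin0 expr0 mulr1.
  rewrite shadow_link /weight => s0.
  rewrite (eq_bigl (pred1 set0)) ?big_pred1_eq ?big_set0 //.
  move=> A; apply/idP/eqP => [|->].
    by rewrite inE cards_eq0 => /andP[/eqP].
  have [B Bs] : exists B, B \in shadow 1 (link v H).
    apply/set0Pn; apply: contraTneq s0 => ->.
    by rewrite big_set0 ltxx.
  move: (Bs); rewrite inE cards_eq0 => /andP[/eqP BE _].
  by rewrite -BE.
rewrite leNgt; apply/negP => Wgt.
have xb0 v : 0 <= x0 v <= x0 v by rewrite x00 lexx.
have yb0 : 0 <= y0 <= y0 by rewrite y00 lexx.
have [|[x y] /= [xb yb S_le] max] := @constrained_max R V (shadow k.+3 H) H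
    'C(l.+1, k.+2)%:R 'C(l.+1, k.+3)%:R k.+2 k.+3 x0 y0.
  by split.
have c0 : 0 < 'C(l.+1, k.+3)%:R :> R by rewrite ltr0n bin_gt0 ltnS.
have a0 : 0 < 'C(l.+1, k.+2)%:R :> R by rewrite ltr0n bin_gt0 ltnW.
have x_ge0 v : 0 <= x v by case/andP: (xb v).
have [y_ge0 y_le] := andP yb.
(* The constraint is tight: otherwise lowering [y] to the root [z] would stay feasible and increase
   the objective. *)
have SE : weight x (shadow k.+3 H) = 'C(l.+1, k.+2)%:R * y ^+ k.+2.
  have [|z z0 zE] := @root_exists (weight x (shadow k.+3 H) / 'C(l.+1, k.+2)%:R) k.+1.
    by rewrite divr_ge0 ?weight_ge0.
  have zy : z <= y.
    by rewrite -(@ler_pXn2r _ k.+2) ?nnegrE // zE ler_pdivrMr // mulrC.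
  have SzE : weight x (shadow k.+3 H) = 'C(l.+1, k.+2)%:R * z ^+ k.+2.
    by rewrite zE mulrC divfK ?gt_eqF.
  have zy0 : 0 <= z <= y0 by rewrite z0 (le_trans zy).
  have Sz : weight x (shadow k.+3 H) <= 'C(l.+1, k.+2)%:R * z ^+ k.+2 by rewrite SzE.
  have := max (x, z) (And3 xb zy0 Sz).
  rewrite /= lerD2l lerN2 ler_pM2l // ler_pXn2r ?nnegrE // => yz.
  by rewrite SzE (_ : z = y) //; apply/le_anti/andP.
have : weight x H <= 'C(l.+1, k.+3)%:R * y ^+ k.+3.
  apply: (@weight_le_of_links R V l k.+1) => //.
  move=> v xv s_gt0.
  have hge := @link_ge_at_max l.+1 k.+1 H x y v x_ge0 y_ge0 _ SE xv s_gt0 _.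
  have {}hge : (l.+1 - k.+2)%:R * y * weight x (link v (shadow k.+3 H))
      <= k.+2%:R * weight x (link v H).
    apply: hge; first by rewrite ltnS ltnW.
    move=> t z /andP[t0 tx] /andP[z0 zy] Sz; apply: (max (_, z)); split=> /=.
    - move=> i; rewrite /update; case: eqP => [->|_]; last exact: xb.
      have /andP[_ xx] := xb v; apply/andP; split; first by rewrite subr_ge0.
      by apply: le_trans xx; rewrite gerBl.
    - by rewrite z0 (le_trans zy).
    - by rewrite Sz.
  (* Here [z] is the [y]-value of the link, so the goal becomes [y <= z]. Induction bounds the link
     weight by [z], the maximum bounds it below by [y], and cancelling [s_v] compares the two. The
     link misses [v], hence has one vertex fewer. *)
  have [|z z0 zE] := @root_exists (weight x (link v (shadow k.+3 H)) / 'C(l, k.+1)%:R) k.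
    by rewrite divr_ge0 ?weight_ge0.
  have b0 : 0 < 'C(l, k.+1)%:R :> R by rewrite ltr0n bin_gt0 ltnW.
  have sE : weight x (link v (shadow k.+3 H)) = 'C(l, k.+1)%:R * z ^+ k.+1.
    by rewrite zE mulrC divfK ?gt_eqF.
  rewrite sE ler_pM2l // ler_pXn2r ?nnegrE //.
  case: l cH kl a0 c0 b0 sE hge {S0 Wgt S_le max SE zE} => // l cH kl a0 c0 b0 sE hge.
  have cl : (#|cover (link v H)| <= l.+1)%N.
    have [->|[B Bl]] := set_0Vmem (link v H); first by rewrite /cover big_set0 cards0.
    apply: leq_trans (subset_leq_card (cover_link H v)) _.
    rewrite -ltnS; apply: leq_trans cH; rewrite [ltnRHS](cardsD1 v).
    move: Bl; rewrite inE => /andP[_ BH].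
    by rewrite (_ : v \in cover H) //; apply/bigcupP; exists (v |: B); rewrite ?setU11.
  have := IH l (link v H) x z x_ge0 z0 (link_rgraph Hr) cl kl.
  rewrite -shadow_link sE => /(_ (lexx _)) hle.
  have k0 : 0 <= k.+2%:R :> R by exact: ler0n.
  have lk : 0 < (l.+1 - k.+1)%:R :> R by rewrite ltr0n subn_gt0.
  have := le_trans hge (ler_wpM2l k0 hle).
  rewrite subSS mulrA natr_bin_succ exprSr.
  have -> : (l.+1 - k.+1)%:R * 'C(l.+1, k.+1)%:R * (z ^+ k.+1 * z)
    = (l.+1 - k.+1)%:R * z * ('C(l.+1, k.+1)%:R * z ^+ k.+1) :> R by ring.
  by rewrite -sE ler_pM2r // ler_pM2l.
move=> Wle; have := max (x0, y0) (And3 xb0 yb0 S0).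
by rewrite leNgt (le_lt_trans (y := 0)) // ?subr_gt0 // subr_le0.
Qed.

End WeightedShadow.

(** * Back to hypergraphs: bounding the support and unit weights *)

(** Otherwise choose [k] vertices of [T] and one covering edge per pair: these edges form a member
    of the forbidden family, embedded by the identity. *)
Lemma covered_card_lt r k (V : finType) (H : {set {set V}}) (T : {set V}) :
  is_rgraph r H -> Kfam_free r k H ->
  (forall u v, u \in T -> v \in T -> u != v ->
     exists2 e, e \in H & [set u; v] \subset e) ->
  (#|T| < k)%N.
Proof.
move=> Hr Hfree cov; rewrite ltnNge; apply/negP => kT.
have [S ST cS] : exists2 S : {set V}, S \subset T & #|S| = k.
  have : (0 < #|[set A : {set V} | (A \subset T) && (#|A| == k)]|)%N.
    by rewrite cards_draws bin_gt0.
  by case/card_gt0P => S; rewrite inE => /andP[ST /eqP cS]; exists S.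
pose pairs := [set P : {set V} | (P \subset S) && (#|P| == 2)].
(* The default [set0] is never reached on [pairs], as every pair is covered. *)
pose edge (P : {set V}) : {set V} := odflt set0 [pick e in H | P \subset e].
have edgeP (P : {set V}) : P \in pairs -> edge P \in H /\ P \subset edge P.
  rewrite inE => /andP[PS cP]; have [u [v [uv PE]]] := cards2P _ cP.
  rewrite /edge; case: pickP => [e /andP[eH Pe]|none]; first by split.
  have [|||e eH se] := cov u v => //.
  - by apply: (subsetP ST); apply: (subsetP PS); rewrite PE !inE eqxx.
  - by apply: (subsetP ST); apply: (subsetP PS); rewrite PE !inE eqxx orbT.
  by have := none e; rewrite /= eH PE se.
have edgeH (e : {set V}) : e \in edge @: pairs -> e \in H.
  by case/imsetP => P /edgeP[eH _] ->.
apply: (Hfree V (edge @: pairs)); last first.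
  by exists id => // e /edgeH; rewrite imset_id.
split.
- by move=> e /edgeH; exact: Hr.
- by rewrite (leq_trans (leq_imset_card _ _)) // cards_draws cS.
exists S => // u v uS vS uv.
have Pp : [set u; v] \in pairs by rewrite inE subUset !sub1set uS vS cards2 uv.
by exists (edge [set u; v]); [exact: imset_f|case: (edgeP _ Pp)].
Qed.

Theorem theorem5p1 (R : realType) (l r : nat) (V : finType) (H : {set {set V}})
    (hr : (2 <= r)%N) (hl : (r <= l)%N)
    (Hr : is_rgraph r H) (Hfree : Kfam_free r l.+1 H) :
  (#|H|%:R / 'C(l, r)%:R : R) `^ (1 / r%:R)
    <= (#|shadow r H|%:R / 'C(l, r.-1)%:R : R) `^ (1 / r.-1%:R).
Proof.
case: r hr hl Hr Hfree => [|[|k]] // _; case: l => // l kl Hr Hfree /=.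
(* With this [y] the shadow hypothesis of [weighted_shadow] is an equality at unit weights, where
   weights count edges. *)
rewrite !div1r; set y := leRHS.
have y0 : 0 <= y by exact: powR_ge0.
have a0 : 0 < 'C(l.+1, k.+1)%:R :> R by rewrite ltr0n bin_gt0 ltnW.
have c0 : 0 < 'C(l.+1, k.+2)%:R :> R by rewrite ltr0n bin_gt0.
have yE : 'C(l.+1, k.+1)%:R * y ^+ k.+1 = #|shadow k.+2 H|%:R.
  rewrite /y -powR_mulrn ?powR_ge0 // -powRrM mulVf ?pnatr_eq0 // powRr1.
    by rewrite mulrC divfK ?gt_eqF.
  by rewrite divr_ge0 ?ler0n.
have weight1 G : weight (fun=> 1 : R) G = #|G|%:R.
  by rewrite /weight (eq_bigr (fun=> 1)) ?sumr_const // => A _; rewrite big1.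
have [x [x0 cov S_le W_ge]] := @concentrate_on_covered R V k H (fun=> 1) (fun=> ler01) Hr.
rewrite !weight1 in S_le W_ge.
set T := [set i | 0 < x i].
(* Edges leaving the support [T] have weight 0, so [H'] keeps the weight of [H] while using at most
   [l.+1] vertices. *)
pose H' := [set e in H | e \subset T].
have cT : (#|T| <= l.+1)%N.
  rewrite -ltnS; apply: covered_card_lt Hr Hfree _ => u v.
  by rewrite !inE; exact: cov.
have WE : weight x H = weight x H'.
  rewrite /weight [LHS](bigID (fun e : {set V} => e \subset T)) /= [X in _ + X]big1.
    by rewrite addr0; apply: eq_bigl => e; rewrite inE.
  move=> e /andP[_ /subsetPn[i ie]]; rewrite inE => xi.
  rewrite (big_setD1 i) //= (_ : x i = 0) ?mul0r //.
  by apply/le_anti; rewrite x0 andbT leNgt.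
have sS : shadow k.+2 H' \subset shadow k.+2 H.
  apply/subsetP => A; rewrite !inE => /andP[-> /existsP[e /andP[]]] /=.
  by rewrite inE => /andP[eH _] Ae; apply/existsP; exists e; rewrite eH.
have Hle : #|H|%:R <= 'C(l.+1, k.+2)%:R * y ^+ k.+2.
  apply: le_trans W_ge _; rewrite WE; apply: (@weighted_shadow R V) => //.
  - by move=> e; rewrite inE => /andP[/Hr].
  - apply: leq_trans cT; apply/subset_leq_card/bigcupsP => e.
    by rewrite inE => /andP[].
  - by rewrite yE; apply: le_trans S_le; exact: weight_sub.
have yr : (y ^+ k.+2) `^ k.+2%:R^-1 = y.
  by rewrite -powR_mulrn // -powRrM mulfV ?pnatr_eq0 // powRr1.
rewrite -[leRHS]yr; apply: ge0_ler_powR.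
- by rewrite invr_ge0.
- by rewrite nnegrE divr_ge0 ?ler0n.
- by rewrite nnegrE exprn_ge0.
- by rewrite ler_pdivrMr // mulrC.
Qed.
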